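(* Let $\boldsymbol E$ be the $(d^2+1)\times(d^2+1)$ block matrix $$\boldsymbol E=\begin{bmatrix}\boldsymbol M&\boldsymbol 0&\cdots&\boldsymbol 0&\boldsymbol 0&-\boldsymbol C_{1,1}\\ \boldsymbol 0&\boldsymbol M&\cdots&\boldsymbol 0&\boldsymbol 0&-\boldsymbol C_{1,2}\\ \vdots&\vdots&\ddots&\vdots&\vdots&\vdots\\ \boldsymbol 0&\boldsymbol 0&\cdots&\boldsymbol M&\boldsymbol 0&-\boldsymbol C_{d,d-1}\\ \boldsymbol 0&\boldsymbol 0&\cdots&\boldsymbol 0&\boldsymbol M&-\boldsymbol C_{d,d}\\ \boldsymbol B^{1,1}&\boldsymbol B^{1,2}&\cdots&\boldsymbol B^{d,d-1}&\boldsymbol B^{d,d}&\boldsymbol 0\end{bmatrix},$$ and let $$\boldsymbol v=(\boldsymbol h_{1,1},\boldsymbol h_{1,2},\dots,\boldsymbol h_{d,d-1},\boldsymbol h_{d,d},\boldsymbol u)^{\mathsf T},\qquad\boldsymbol b=(\boldsymbol 0,\boldsymbol 0,\dots,\boldsymbol 0,\boldsymbol 0,\boldsymbol f)^{\mathsf T},$$ with $\boldsymbol h_{\alpha,\beta}\in\mathbb R^N$ and $\boldsymbol u\in\mathbb R^{\mathring N}$. Then solving the system $$\boldsymbol D\boldsymbol u=\sum_{\alpha=1}^d\sum_{\beta=1}^d\boldsymbol B^{\alpha,\beta}\boldsymbol M^{-1}\boldsymbol C_{\alpha,\beta}\boldsymbol u=\boldsymbol f$$ is equivalent to solving $\boldsymbol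 E\boldsymbol v=\boldsymbol b$ for $\boldsymbol u$; that is, $\boldsymbol u\in\mathbb R^{\mathring N}$ satisfies $\boldsymbol D\boldsymbol u=\boldsymbol f$ if and only if there exist $\boldsymbol h_{\alpha,\beta}\in\mathbb R^N$ ($\alpha,\beta=1,\dots,d$) such that $\boldsymbol E\boldsymbol v=\boldsymbol b$.
   Context: Let $\Omega\subset\mathbb R^d$ be an open bounded Lipschitz domain with outward pointing unit normal $\boldsymbol n=(n_1,\dots,n_d)$ on $\partial\Omega$. Let $\boldsymbol A=[\boldsymbol A^{\alpha,\beta}]_{\alpha,\beta=1}^d\in L_\infty(\Omega)^{d\times d}$ be symmetric positive definite matrix valued, such that the operator $u\mapsto\boldsymbol A:\mathrm D^2u=\operatorname{trace}(\boldsymbol A^{\mathsf T}\mathrm D^2u)$ is uniformly elliptic, and let $f\in L_2(\Omega)$. Let $\mathscr T$ be a conforming triangulation of $\Omega$: a finite family of open simplices (segments for $d=1$, triangles for $d=2$, tetrahedra for $d=3$) such that for any $K,J\in\mathscr T$ the set $\overline K\cap\overline J$ is a full subsimplex (either $\emptyset$, a vertex, an edge, a face, or the whole of $\overline K$ and $\overline J$) of both $\overline K$ and $\overline J$, and $\bigcup_{K\in\mathscr T}\overline K=\overline\Omega$. Fix an integer $p\ge1$, let $\mathbb P^p$ be the polynomials in $d$ variables of degree at most $p$, and put $$\mathbb V:=\{\Phi\in H^1(\Omega):\Phi|_K\in\mathbb P^p\ \forall K\in\mathscr T\},\qquad\mathring{\mathbb V}:=\mathbb V\cap H^1_0(\Omega),$$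 $\mathring N:=\dim\mathring{\mathbb V}$, $N:=\dim\mathbb V=\mathring N+N_\partial$. Let $\mathring{\boldsymbol\Phi}=(\mathring\Phi_1,\dots,\mathring\Phi_{\mathring N})^{\mathsf T}$ be the column vector of a basis of $\mathring{\mathbb V}$, and $\boldsymbol\Phi=(\mathring\Phi_1,\dots,\mathring\Phi_{\mathring N},\Phi_1,\dots,\Phi_{N_\partial})^{\mathsf T}$ that of a basis of $\mathbb V$ extending it. Notation: $\langle v,w\rangle:=\int_\Omega vw$ and $\langle v,w\rangle_{\partial\Omega}:=\int_{\partial\Omega}vw$, applied entrywise to (matrix) products of vectors/matrices of functions; on $\partial\Omega$ derivatives of finite element functions are traces of the piecewise polynomial derivatives from the adjacent elements. For $\alpha,\beta=1,\dots,d$, $$\boldsymbol B^{\alpha,\beta}:=\langle\mathring{\boldsymbol\Phi},\boldsymbol A^{\alpha,\beta}\boldsymbol\Phi^{\mathsf T}\rangle\in\mathbb R^{\mathring N\times N},\qquad\boldsymbol M:=\langle\boldsymbol\Phi,\boldsymbol\Phi^{\mathsf T}\rangle\in\mathbb R^{N\times N},$$ $$\boldsymbol C_{\alpha,\beta}:=-\langle\partial_\beta\boldsymbol\Phi,\partial_\alpha\mathring{\boldsymbol\Phi}^{\mathsf T}\rangle+\langle\boldsymbol\Phi\,n_\beta,\partial_\alpha\mathring{\boldsymbol\Phi}^{\mathsf T}\rangle_{\partial\Omega}\in\mathbb R^{N\times\mathring N},\qquad\boldsymbol f:=\langle f,\mathring{\boldsymbol\Phi}\rangle\in\mathbb R^{\mathring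 N}.$$ In $\boldsymbol E$, the first $d^2$ block rows and columns are indexed by the pairs $(\alpha,\beta)$ in lexicographic order; the vectors $\boldsymbol v,\boldsymbol b$ are block column vectors conforming to $\boldsymbol E$. *)

(* Defs.v *)
From HB Require Import structures.
From mathcomp Require Import all_boot all_order all_algebra.
From mathcomp Require mpoly.

Set Implicit Arguments. Unset Strict Implicit. Unset Printing Implicit Defensive.

(* The notations of mpoly clash with those of mathcomp-analysis, hence the
   separate module. *)
Module PolynomialFunction.
Import GRing.Theory mpoly.
Local Open Scope ring_scope.

(* [msize] is one more than the total degree *)
Definition polynomial_on (R : comNzRingType) (d p : nat)
    (D : 'rV[R]_d -> Prop) (g : 'rV[R]_d -> R) : Prop :=
  exists2 P : {mpoly R[d]}, (msize P <= p.+1)%N &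
    forall x, D x -> g x = P.@[x ord0].

End PolynomialFunction.
Export PolynomialFunction.

From mathcomp Require Import all_classical all_reals all_analysis.
Import Order.TTheory GRing.Theory Num.Theory.
Import numFieldNormedType.Exports.
Local Open Scope classical_set_scope.
Local Open Scope ring_scope.

(* ['rV[R]_n] carries the sigma-algebra generated by the coordinates, i.e. the
   Borel sigma-algebra; the measure is the n-fold product of the
   one-dimensional Lebesgue measure. *)

Definition rV_display : measure_display.
Proof. exact: default_measure_display. Qed.

Section measurable_rV.
Variables (R : realType) (n : nat).

Definition rV_coord (i : 'I_n) (x : 'rV[R]_n) : measurableTypeR R := x ord0 i.

Let rV_set0 : g_sigma_preimage rV_coord set0.
Proof. exact: sigma_algebra0. Qed.

Let rV_setC A : g_sigma_preimage rV_coord A -> g_sigma_preimage rV_coord (~` A).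
Proof. exact: sigma_algebraC. Qed.

Let rV_bigcup (F : _^nat) : (forall i, g_sigma_preimage rV_coord (F i)) ->
  g_sigma_preimage rV_coord (\bigcup_i (F i)).
Proof. exact: sigma_algebra_bigcup. Qed.

HB.instance Definition _ := @isMeasurable.Build rV_display
  'rV[R]_n (g_sigma_preimage rV_coord) rV_set0 rV_setC rV_bigcup.

Lemma measurable_rV_coord (i : 'I_n) : measurable_fun setT (rV_coord i).
Proof.
move=> _ Y mY; rewrite setTI; apply: sub_sigma_algebra => /=.
rewrite -bigcup_seq/=; exists i => /=; first by rewrite mem_index_enum.
by exists Y => //; rewrite setTI.
Qed.

End measurable_rV.

Section lebesgue_rV.
Variable R : realType.

Definition rV_snoc n (z : 'rV[R]_n * measurableTypeR R) : 'rV[R]_n.+1 :=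
  \row_j (if unlift ord_max j is Some i then z.1 ord0 i else z.2).

Lemma measurable_rV_snoc n : measurable_fun setT (@rV_snoc n).
Proof.
have mcoord i : measurable_fun setT (@rV_coord R n.+1 i \o @rV_snoc n).
  rewrite /comp /rV_coord /rV_snoc.
  case: (unliftP ord_max i) => [j ->|->].
    rewrite (_ : (fun _ => _) = @rV_coord R n j \o fst).
      apply: measurableT_comp.
        exact: measurable_rV_coord.
      exact: measurable_fst.
    by apply/funext => z; rewrite mxE liftK.
  rewrite (_ : (fun _ => _) = snd) //.
  by apply/funext => z; rewrite mxE unlift_none.
move=> _ Y mY; rewrite setTI.
suff sub : g_sigma_preimage (@rV_coord R n.+1)
    `<=` [set A | measurable (@rV_snoc n @^-1` A)].
  exact: (sub Y mY).
apply: smallest_sub.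
  split => [|A mA|F mF].
  - by rewrite /= preimage_set0.
  - by rewrite /= setTD -preimage_setC; apply: measurableC; exact: mA.
  - by rewrite /= preimage_bigcup; apply: bigcup_measurable => k _; exact: mF.
rewrite -bigcup_seq => A [i _ [B mB <-]].
by rewrite /= setTI -comp_preimage -[X in measurable X]setTI; exact: mcoord.
Qed.

Definition lebesgue_step n (nu : {measure set 'rV[R]_n -> \bar R}) :=
  pushforward (nu \x @lebesgue_measure R)%E (@rV_snoc n).

HB.instance Definition _ n nu := Measure.copy (@lebesgue_step n nu)
  (measure_function_pushforward__canonical__measure_function_Measure
    (nu \x @lebesgue_measure R)%E (@measurable_rV_snoc n)).

Fixpoint lebesgue_rV n : {measure set 'rV[R]_n -> \bar R} :=
  if n is n'.+1 then lebesgue_step (lebesgue_rV n') else \d_(0 : 'rV[R]_0).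

Lemma lebesgue_rV_box n (A : 'I_n -> set (measurableTypeR R)) :
  (forall i, measurable (A i)) ->
  lebesgue_rV n [set x | forall i, A i (x ord0 i)] =
  (\prod_(i < n) lebesgue_measure (A i))%E.
Proof.
elim: n => [|n IHn] in A * => mA /=.
  by rewrite big_ord0 diracE mem_set // => -[].
pose A' i := A (widen_ord (leqnSn n) i).
pose box := [set x : 'rV[R]_n | forall i, A' i (x ord0 i)].
have widenE i : lift ord_max i = widen_ord (leqnSn n) i.
  by apply/val_inj; rewrite /= /bump leqNgt ltn_ord.
have mbox : measurable box.
  rewrite (_ : box = \big[setI/setT]_(i < n) (rV_coord i @^-1` A' i)).
    apply: bigsetI_measurable => i _.
    by rewrite -[X in measurable X]setTI; apply: measurable_rV_coord => //; exact: mA.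
  rewrite -bigcap_seq; apply/seteqP; split => x /= xA i; first by move=> _; exact: xA.
  by apply: xA; rewrite /= mem_index_enum.
transitivity ((lebesgue_rV n \x lebesgue_measure)%E (box `*` A ord_max)).
  rewrite /lebesgue_step /pushforward; congr (_ \x _)%E.
  apply/seteqP; split => [[x y] /= xyA|[x y] /= [xA yA] j].
    split=> [i|]; last by have := xyA ord_max; rewrite mxE unlift_none.
    by have := xyA (lift ord_max i); rewrite mxE liftK widenE.
  rewrite mxE; case: (unliftP ord_max j) => [i ->|-> //] /=.
  by rewrite widenE; exact: xA.
rewrite product_measure1E // big_ord_recr /=; congr (_ * _)%E.
by apply: IHn => i; exact: mA.
Qed.

End lebesgue_rV.
Arguments lebesgue_rV R n : clear implicits.

Definition dot (R : realType) n (x y : 'rV[R]_n) : R := (x *m y^T) ord0 ord0.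

Section domain.
Variables (R : realType) (n : nat).
Local Notation Rn := 'rV[R]_n.+1.
Implicit Types (Omega : set Rn) (x y e nu : Rn).

Definition boundary Omega : set Rn := closure Omega `\` interior Omega.

(* Near each boundary point, Omega is the part of a ball above the graph of a
   Lipschitz function gamma over the hyperplane orthogonal to a unit vector e. *)
Definition lipschitz_boundary Omega :=
  forall x, boundary Omega x ->
  exists r : R, exists e, exists gamma : Rn -> R,
  [/\ 0 < r, dot e e = 1, lipschitz gamma &
      forall y, ball x r y ->
        (Omega y <-> gamma (y - dot y e *: e) < dot y e)].

Definition bounded_lipschitz_domain Omega :=
  [/\ open Omega, Omega !=set0, connected Omega, bounded_set Omega
    & lipschitz_boundary Omega].

(* nu is the unit normal at x of a half-space {y | (y - x) . nu < 0} that
   agrees with Omega near x up to cones of arbitrarily small opening. *)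
Definition is_outer_normal Omega x nu :=
  dot nu nu = 1 /\
  forall eps : R, 0 < eps -> \forall y \near x,
    (Omega y -> dot (y - x) nu <= eps * `|y - x|) /\
    (dot (y - x) nu < - eps * `|y - x| -> Omega y).

Definition outer_normal Omega x : Rn := xget 0 (is_outer_normal Omega x).

End domain.

(* Functions on Omega are total functions on R^n, of which only the values on
   Omega matter; they are identified when equal almost everywhere in Omega. *)

Section sobolev.
Variables (R : realType) (n : nat).
Local Notation Rn := 'rV[R]_n.+1.
Local Notation mu := (lebesgue_rV R n.+1).
Implicit Types (Omega : set Rn) (u v g phi : Rn -> R) (a : 'I_n.+1).

Definition ae_in Omega (P : Rn -> Prop) := {ae mu, forall x, Omega x -> P x}.

Definition Lp_on (p : \bar R) Omega u := (u \_ Omega : Rn -> R) \in Lfun mu p.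

Definition inner Omega u v : R := \int[mu]_(x in Omega) (u x * v x).

Definition partial a phi : Rn -> R := fun x => 'D_(delta_mx ord0 a) phi x.

Definition partials (s : seq 'I_n.+1) phi : Rn -> R := foldr partial phi s.

Definition smooth phi := forall s,
  continuous (partials s phi) /\
  forall a x, derivable (partials s phi) x (delta_mx ord0 a).

Definition test_function Omega phi :=
  let supp := closure [set x | phi x != 0] in
  [/\ smooth phi, compact supp & supp `<=` Omega].

Definition is_weak_partial Omega a u g :=
  Lp_on 2%:E Omega g /\
  forall phi, test_function Omega phi ->
    inner Omega u (partial a phi) = - inner Omega g phi.

(* The weak derivative in L_2(Omega), unique up to a null set; all uses below
   only depend on its class. *)
Definition weak_partial Omega a u : Rn -> R :=
  xget (fun=> 0) (is_weak_partial Omega a u).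

Definition H1 Omega u :=
  Lp_on 2%:E Omega u /\ forall a, exists g, is_weak_partial Omega a u g.

Definition H1_sqnorm Omega u : R :=
  inner Omega u u +
  \sum_a inner Omega (weak_partial Omega a u) (weak_partial Omega a u).

Definition H10 Omega u :=
  H1 Omega u /\
  forall eps : R, 0 < eps -> exists2 phi,
    test_function Omega phi & H1_sqnorm Omega (u \- phi) < eps.

End sobolev.

Section coefficient.
Variables (R : realType) (n : nat).
Local Notation Rn := 'rV[R]_n.+1.
Implicit Types (Omega : set Rn) (A : Rn -> 'M[R]_n.+1).

Definition quad_form (S : 'M[R]_n.+1) (xi : Rn) : R := dot (xi *m S) xi.

Definition sym_posdef (S : 'M[R]_n.+1) :=
  S^T = S /\ forall xi, xi != 0 -> 0 < quad_form S xi.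

Definition uniformly_elliptic Omega A :=
  exists lam Lam : R, 0 < lam /\
    ae_in Omega (fun x => forall xi,
      lam * dot xi xi <= quad_form (A x) xi <= Lam * dot xi xi).

Definition admissible_coefficient Omega A :=
  [/\ forall a b, Lp_on +oo%E Omega (fun x => A x a b),
      ae_in Omega (fun x => sym_posdef (A x))
    & uniformly_elliptic Omega A].

End coefficient.

(* A simplex of dimension n in R^k is given by the matrix of its n.+1 vertices
   (one per row). *)

Section simplices.
Variables (R : realType) (n k : nat).
Implicit Types (K : 'M[R]_(n.+1, k)).

Definition edges K : 'M[R]_(n, k) :=
  \matrix_(i < n) (row (lift ord0 i) K - row ord0 K).

Definition affinely_independent K := row_free (edges K).

Definition open_simplex K : set 'rV[R]_k :=
  [set x | exists2 l : 'rV[R]_n.+1,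
     (forall i, 0 < l ord0 i) /\ \sum_i l ord0 i = 1 & x = l *m K].

(* the closed subsimplex spanned by the vertices in S; empty for S = set0 *)
Definition subsimplex K (S : {set 'I_n.+1}) : set 'rV[R]_k :=
  [set x | exists2 l : 'rV[R]_n.+1,
     [/\ forall i, 0 <= l ord0 i, forall i, i \notin S -> l ord0 i = 0
       & \sum_i l ord0 i = 1]
   & x = l *m K].

Definition reference_simplex : set 'rV[R]_n :=
  [set xi | (forall i, 0 < xi ord0 i) /\ \sum_i xi ord0 i < 1].

(* Integral over the simplex K with respect to the n-dimensional surface
   measure, through the affine parametrisation from the reference simplex;
   the square root of the Gram determinant is its Jacobian. *)
Definition simplex_integral K (g : 'rV[R]_k -> R) : R :=
  Num.sqrt (\det (edges K *m (edges K)^T)) *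
  \int[lebesgue_rV R n]_(xi in reference_simplex) g (row ord0 K + xi *m edges K).

End simplices.

Section triangulation.
Variables (R : realType) (n m : nat).
Local Notation Rn := 'rV[R]_n.+1.
Implicit Types (Omega : set Rn) (T : 'I_m -> 'M[R]_(n.+2, n.+1)).

Definition conforming_triangulation Omega T :=
  [/\ forall k, affinely_independent (T k),
      injective (fun k => open_simplex (T k)),
      forall k j, exists S S',
        closure (open_simplex (T k)) `&` closure (open_simplex (T j)) =
          subsimplex (T k) S /\
        closure (open_simplex (T k)) `&` closure (open_simplex (T j)) =
          subsimplex (T j) S'
    & \bigcup_(k in setT) closure (open_simplex (T k)) = closure Omega].

(* one-sided limit at x from within the open simplex K *)
Definition trace_from (K : 'M[R]_(n.+2, n.+1)) (g : Rn -> R) (x : Rn) : R :=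
  lim (g y @[y --> within (open_simplex K) (nbhs x)]).

(* The boundary of Omega is the union of the facets (of elements of T) that it
   contains, each of which belongs to exactly one element. The integrand may
   depend on that adjacent element. [row' i K] lists the vertices of the facet
   opposite to vertex i. *)
Definition boundary_integral Omega T (g : 'I_m -> Rn -> R) : R :=
  \sum_(k < m)
    \sum_(i < n.+2 | `[< subsimplex (T k) [set~ i] `<=` boundary Omega >])
      simplex_integral (row' i (T k) : 'M[R]_(n.+1, n.+1)) (g k).

End triangulation.

Section fem.
Variables (R : realType) (n m : nat).
Local Notation Rn := 'rV[R]_n.+1.
Variables (Omega : set Rn) (T : 'I_m -> 'M[R]_(n.+2, n.+1)) (p : nat).

Definition fe_space : set (Rn -> R) := [set v | H1 Omega v /\
  forall k, polynomial_on p (open_simplex (T k)) v].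

Definition fe_space0 : set (Rn -> R) := fe_space `&` H10 Omega.

End fem.

Definition is_basis (R : realType) n (Omega : set 'rV[R]_n.+1)
    (V : set ('rV[R]_n.+1 -> R)) N (Phi : 'I_N -> 'rV[R]_n.+1 -> R) :=
  [/\ forall i, V (Phi i),
      forall c : 'I_N -> R,
        ae_in Omega (fun x => \sum_i c i * Phi i x = 0) -> forall i, c i = 0
    & forall v, V v -> exists c : 'I_N -> R,
        ae_in Omega (fun x => v x = \sum_i c i * Phi i x)].

Definition join_family (X : Type) N1 N2 (f : 'I_N1 -> X) (g : 'I_N2 -> X)
    (i : 'I_(N1 + N2)) : X :=
  match fintype.split i with inl j => f j | inr k => g k end.

Section matrices.
Variables (R : realType) (n m : nat).
Local Notation Rn := 'rV[R]_n.+1.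
Variables (Omega : set Rn) (T : 'I_m -> 'M[R]_(n.+2, n.+1)).
Variables (A : Rn -> 'M[R]_n.+1) (f : Rn -> R).
Variables (N0 Nb : nat) (Phi0 : 'I_N0 -> Rn -> R) (Phib : 'I_Nb -> Rn -> R).
Local Notation N := (N0 + Nb)%N.
Local Notation Phi := (join_family Phi0 Phib).
Implicit Types a b : 'I_n.+1.

(* [A x a b] is the entry A^{a,b}(x); the pair of indices (i, j) of a Gram
   matrix follows the convention <v, w^T>_{ij} = <v_i, w_j>. *)
Definition B_mx a b : 'M[R]_(N0, N) :=
  \matrix_(i, j) inner Omega (Phi0 i) (fun x => A x a b * Phi j x).

Definition M_mx : 'M[R]_N := \matrix_(i, j) inner Omega (Phi i) (Phi j).

Definition C_mx a b : 'M[R]_(N, N0) := \matrix_(i, j)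
  (- inner Omega (weak_partial Omega b (Phi i)) (weak_partial Omega a (Phi0 j))
   + boundary_integral Omega T (fun k x =>
       trace_from (T k) (Phi i) x * outer_normal Omega x ord0 b *
       trace_from (T k) (partial a (Phi0 j)) x)).

Definition f_vec : 'cV[R]_N0 := \col_i inner Omega f (Phi0 i).

Definition D_mx : 'M[R]_N0 :=
  \sum_a \sum_b B_mx a b *m invmx M_mx *m C_mx a b.

(* lexicographic order on pairs: block k (from 0) has index (k / d, k mod d) *)
Definition idx1 (k : 'I_(n.+1 * n.+1)) : 'I_n.+1 := inord (k %/ n.+1).
Definition idx2 (k : 'I_(n.+1 * n.+1)) : 'I_n.+1 := inord (k %% n.+1).

Local Notation blocks := (\sum_(k < n.+1 * n.+1) N)%N.

Definition E_mx : 'M[R]_(blocks + N0) :=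
  block_mx (\mxdiag_(k < n.+1 * n.+1) M_mx)
           (\mxcol_(k < n.+1 * n.+1) - C_mx (idx1 k) (idx2 k))
           (\mxrow_(k < n.+1 * n.+1) B_mx (idx1 k) (idx2 k))
           0.

Definition v_vec (h : 'I_n.+1 -> 'I_n.+1 -> 'cV[R]_N) (u : 'cV[R]_N0) :
    'cV[R]_(blocks + N0) :=
  col_mx (\mxcol_(k < n.+1 * n.+1) h (idx1 k) (idx2 k)) u.

Definition b_vec : 'cV[R]_(blocks + N0) := col_mx 0 f_vec.

End matrices.

(* Main.v *)
Require Import Defs.
From mathcomp Require Import all_boot all_order all_algebra.
From mathcomp Require Import all_classical all_reals all_analysis.
Import Order.TTheory GRing.Theory Num.Theory.
Import numFieldNormedType.Exports.
Local Open Scope classical_set_scope.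
Local Open Scope ring_scope.

(** The block system is the system D u = f with auxiliary unknowns h_(a,b):
    its first d^2 block rows read M h_(a,b) = C_(a,b) u, its last block row
    reads sum_(a,b) B^(a,b) h_(a,b) = f.  As soon as M is invertible, the first
    rows force h_(a,b) = M^-1 C_(a,b) u, and substituting these values into the
    last row turns it into D u = f ([block_system_elimination]); conversely
    these values of h solve the system whenever D u = f.

    The analytic content is therefore the invertibility of the mass matrix M
    ([M_mx_unit]).  It is a Gram matrix in L_2(Omega): if c M = 0, then
    0 = c M c^T is the integral over Omega of (sum_i c_i Phi_i)^2, so that
    sum_i c_i Phi_i vanishes almost everywhere in Omega, and c = 0 because the
    Phi_i are linearly independent modulo null sets ([gram_mx_unit]).  All these integrals
    make sense because finite element functions, as elements of H^1(Omega), are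
    square integrable. *)

(** * Gram matrices in L_2 *)

Section Gram.
Context d (X : measurableType d) (R : realType).
Variable mu : {measure set X -> \bar R}.

Lemma Lfun_lincomb (q : \bar R) (q1 : (1 <= q)%E) N (psi : 'I_N -> X -> R)
    (c : 'I_N -> R) :
  (forall i, psi i \in Lfun mu q) ->
  (fun x => \sum_i c i * psi i x) \in Lfun mu q.
Proof.
move=> hpsi; have [L0 closed] := Lfun_submod_closed mu q1.
rewrite (_ : (fun _ => _) = \sum_i c i *: psi i); last by rewrite fct_sumE.
elim/big_ind: _ => [//|g h gL hL|i _]; first by rewrite -[g]scale1r; exact: closed.
by rewrite -[_ *: _]addr0; exact: closed.
Qed.

Lemma Rintegral_lincomb N (g : 'I_N -> X -> R) (c : 'I_N -> R) :
  (forall i, g i \in Lfun mu 1) ->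
  \int[mu]_x (\sum_i c i * g i x) = \sum_i c i * \int[mu]_x g i x.
Proof.
move=> hg; have ig i : mu.-integrable setT (EFin \o g i).
  exact/Lfun1_integrable.
rewrite /Rintegral; under eq_integral do rewrite -sumEFin.
have icg i : mu.-integrable setT (fun x => (c i * g i x)%:E).
  by under eq_fun do rewrite EFinM; exact: (integrableZl _ _ (ig i)).
rewrite integral_sum // -sum_fine; last by move=> i _; exact: integrable_fin_num.
by apply: eq_bigr => i _; rewrite -RintegralZl.
Qed.

Lemma Rintegral_sqr_eq0 (g : X -> R) : g \in Lfun mu 2%:E ->
  \int[mu]_x (g x * g x) = 0 -> {ae mu, forall x, g x = 0}.
Proof.
move=> gL int0.
have /Lfun1_integrable ig : g \* g \in Lfun mu 1 by exact: Lfun2_mul_Lfun1.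
have : (\int[mu]_x `|(g x * g x)%:E| = 0)%E.
  under eq_integral do rewrite gee0_abs ?lee_fin -?expr2 ?sqr_ge0 // expr2.
  by rewrite -[LHS]fineK ?integrable_fin_num//; congr EFin.
move/ae_eq_integral_abs => /(_ measurableT); case/integrableP: ig => mg _.
move=> /(_ mg); apply: filterS => x /(_ I) [] /eqP.
by rewrite mulf_eq0 orbb => /eqP.
Qed.

Lemma gram_mx_unit N (psi : 'I_N -> X -> R) :
  (forall i, psi i \in Lfun mu 2%:E) ->
  (forall c : 'I_N -> R,
    {ae mu, forall x, \sum_i c i * psi i x = 0} -> forall i, c i = 0) ->
  (\matrix_(i, j) \int[mu]_x (psi i x * psi j x)) \in unitmx.
Proof.
move=> psiL indep; set G := \matrix_(_, _) _.
rewrite -row_free_unit; apply: inj_row_free => c cG0.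
pose s x := \sum_i c ord0 i * psi i x.
have sL : s \in Lfun mu 2%:E by apply: Lfun_lincomb => //; rewrite lee1n.
(* the entries of c G are the inner products of the combination s with psi *)
have s_orth j : \int[mu]_x (psi j x * s x) = 0.
  have /matrixP/(_ ord0 j) := cG0; rewrite !mxE => <-.
  under eq_Rintegral do rewrite mulrC /s mulr_suml.
  under eq_Rintegral do under eq_bigr do rewrite -mulrA.
  rewrite (Rintegral_lincomb _ (fun i => psi i \* psi j)).
    by apply: eq_bigr => i _; rewrite mxE.
  by move=> i; exact: Lfun2_mul_Lfun1.
have s0 : {ae mu, forall x, s x = 0}.
  apply: Rintegral_sqr_eq0 => //.
  under eq_Rintegral do rewrite {1}/s mulr_suml.
  under eq_Rintegral do under eq_bigr do rewrite -mulrA.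
  rewrite (Rintegral_lincomb _ (fun i => psi i \* s)).
    by rewrite big1 // => i _; rewrite s_orth mulr0.
  by move=> i; exact: Lfun2_mul_Lfun1.
by apply/rowP => i; rewrite mxE; exact: indep s0 i.
Qed.

End Gram.

(** * The mass matrix *)

(** Extending functions by zero outside Omega turns integrals over Omega into
    integrals over the whole space, where [gram_mx_unit] applies. *)
Lemma M_mx_unit (R : realType) n (Omega : set 'rV[R]_n.+1)
    (V : set ('rV[R]_n.+1 -> R)) N0 Nb
    (Phi0 : 'I_N0 -> 'rV[R]_n.+1 -> R) (Phib : 'I_Nb -> 'rV[R]_n.+1 -> R) :
  V `<=` Lp_on 2%:E Omega ->
  is_basis Omega V (join_family Phi0 Phib) ->
  M_mx Omega Phi0 Phib \in unitmx.
Proof.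
move=> VL2 [VPhi indep _]; set Phi := join_family Phi0 Phib in VPhi indep *.
pose psi i : 'rV[R]_n.+1 -> R := Phi i \_ Omega.
rewrite (_ : M_mx _ _ _ =
  \matrix_(i, j) \int[lebesgue_rV R n.+1]_x (psi i x * psi j x)).
  apply: gram_mx_unit => [i|c c0]; first exact: VL2 (VPhi i).
  apply: indep; apply: filterS c0 => x s0 Ox; rewrite -[RHS]s0.
  by apply: eq_bigr => i _; rewrite /psi patchE mem_set.
apply/matrixP => i j; rewrite !mxE /inner Rintegral_mkcond.
apply: eq_Rintegral => x _; rewrite /psi !patchE.
by case: ifP => // _; rewrite mulr0.
Qed.

(** * Block elimination *)

(** Gaussian elimination by the block diagonal part: the sum of the
    B_k M^-1 C_k is its Schur complement in the block matrix. *)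
Lemma block_system_elimination (F : comUnitRingType) N N0 (r : nat)
    (M : 'M[F]_N) (C : 'I_r -> 'M[F]_(N, N0)) (B : 'I_r -> 'M[F]_(N0, N))
    (h : 'I_r -> 'cV[F]_N) (u f : 'cV[F]_N0) :
  M \in unitmx ->
  block_mx (\mxdiag_k M) (\mxcol_k - C k) (\mxrow_k B k) 0
    *m col_mx (\mxcol_k h k) u = col_mx 0 f <->
  (forall k, h k = invmx M *m C k *m u) /\
  (\sum_k B k *m invmx M *m C k) *m u = f.
Proof.
move=> Mu; rewrite mul_block_col mul_mxdiag_mxcol mxcol_mul -mxcolD.
rewrite mul_mxrow_mxcol mul0mx addr0 mulmx_suml.
have rows k : (M *m h k + - C k *m u = 0) <-> (h k = invmx M *m C k *m u).
  rewrite mulNmx; split=> [/subr0_eq eqk|->].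
    by rewrite -mulmxA -eqk mulKmx.
  by rewrite -mulmxA mulKVmx // subrr.
have last_row : (forall k, h k = invmx M *m C k *m u) ->
    \sum_k B k *m h k = \sum_k B k *m invmx M *m C k *m u.
  by move=> hE; apply: eq_bigr => k _; rewrite hE !mulmxA.
split=> [/eq_col_mx[]|[hE <-]].
  rewrite -mxcol0 => /eq_mxcolP eqs <-.
  have hE k : h k = invmx M *m C k *m u by apply/rows/eqs.
  by split=> //; rewrite last_row.
rewrite last_row //; congr col_mx; rewrite -mxcol0.
by apply: eq_mxcol => k; apply/rows/hE.
Qed.

(** Quotient and remainder by the dimension form a bijection from block
    positions onto pairs of indices: it is injective by Euclidean division, and
    both sides have the same cardinality. *)
Lemma sum_idx (V : nmodType) n (F : 'I_n.+1 -> 'I_n.+1 -> V) :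
  \sum_a \sum_b F a b = \sum_(k < n.+1 * n.+1) F (idx1 k) (idx2 k).
Proof.
rewrite pair_bigA (reindex (fun k => (@idx1 n k, @idx2 n k))) //=.
apply/onW_bij/inj_card_bij; last by rewrite card_prod !card_ord.
move=> j k [/(congr1 val) + /(congr1 val)].
rewrite /= !inordK ?ltn_mod ?ltn_divLR // => eqd eqm.
by apply/val_inj; rewrite /= (divn_eq j n.+1) eqd eqm -divn_eq.
Qed.

(* The space dimension is d = n.+1. *)
Theorem lemma3p4 (R : realType) (n : nat)
  (Omega : set 'rV[R]_n.+1) (hOmega : bounded_lipschitz_domain Omega)
  (A : 'rV[R]_n.+1 -> 'M[R]_n.+1) (hA : admissible_coefficient Omega A)
  (f : 'rV[R]_n.+1 -> R) (hf : Lp_on 2%:E Omega f)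
  (m : nat) (T : 'I_m -> 'M[R]_(n.+2, n.+1))
  (hT : conforming_triangulation Omega T)
  (p : nat) (hp : (1 <= p)%N)
  (N0 Nb : nat)
  (Phi0 : 'I_N0 -> 'rV[R]_n.+1 -> R) (Phib : 'I_Nb -> 'rV[R]_n.+1 -> R)
  (hPhi0 : is_basis Omega (fe_space0 Omega T p) Phi0)
  (hPhi : is_basis Omega (fe_space Omega T p) (join_family Phi0 Phib))
  (u : 'cV[R]_N0) :
  D_mx Omega T A Phi0 Phib *m u = f_vec Omega f Phi0 <->
  exists h : 'I_n.+1 -> 'I_n.+1 -> 'cV[R]_(N0 + Nb),
    E_mx Omega T A Phi0 Phib *m v_vec h u = b_vec Omega f Nb Phi0.
Proof.
have Mu : M_mx Omega Phi0 Phib \in unitmx.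
  by apply: M_mx_unit hPhi => v [[]].
pose C k := C_mx Omega T Phi0 Phib (idx1 k) (idx2 k).
pose B k := B_mx Omega A Phi0 Phib (idx1 k) (idx2 k).
have DE : D_mx Omega T A Phi0 Phib =
    \sum_k B k *m invmx (M_mx Omega Phi0 Phib) *m C k by exact: sum_idx.
have sys h := block_system_elimination _ _ _ _ _ C B
  (fun k => h (idx1 k) (idx2 k)) u (f_vec Omega f Phi0) Mu.
rewrite DE; split=> [Du|[h /sys []//]].
exists (fun a b =>
  invmx (M_mx Omega Phi0 Phib) *m C_mx Omega T Phi0 Phib a b *m u).
exact/sys.
Qed.
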